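(* Let $s \geq 0$, $\tilde r > 0$, $M = sI + \tilde r K_n$, $r = s + \tilde r$ and $\mu = \tilde r / r$, where $K_n \in \mathbb{C}^{n\times n}$ ($n \geq 2$) has as its field of values the closed unit disk. Let $b_j = s + \tilde r e^{\mathbf{i}\phi_j}$ with $\phi_j \in (0,\tfrac{\pi}{2})$, and assume $|b_j| < r$ and $\tilde r < r$, so $\mu \in (0,1)$. Then the sequence $\{\phi_k\}_{k \geq j}$ produced by optimal cuts (as described in the context), which satisfies for all $k \geq j$ the recursion $$\phi_{k+1} = -\phi_k + 2\arctan\left( \frac{\tilde r \sin\phi_k - t_k\cos\phi_k}{\tilde r\cos\phi_k + t_k \sin\phi_k} \right), \qquad t_k = -s\sin\phi_k + \sqrt{s^2\sin^2\phi_k + 2 s\tilde r(1-\cos\phi_k)},$$ converges to zero Q-linearly with rate $$\frac{2\left(1 - \sqrt{1-\mu}\right)}{\mu} - 1.$$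
   Context: The field of values of $A\in\mathbb{C}^{n\times n}$ is $W(A) = \{x^*Ax : \|x\|=1\}$ and its numerical radius is $r(A) = \max\{|z| : z \in W(A)\}$. For an angle $\theta$, $L_\theta$ denotes the supporting line $\{e^{-\mathbf{i}\theta}(\lambda_\theta + \mathbf{i}t): t \in \mathbb{R}\}$ of $W(M)$, where $\lambda_\theta$ is the largest eigenvalue of $\tfrac12(e^{\mathbf{i}\theta}M + e^{-\mathbf{i}\theta}M^* )$. $W(M)$ is the closed disk of radius $\tilde r$ centered at $s$ on the real axis, with outermost point $b_\star = s + \tilde r = r = r(M)$. The line $L_0$ is the vertical tangent to $W(M)$ at $b_\star$. For $\phi \in (0,\pi)$, the line $L_{-\phi}$ is the tangent to $W(M)$ at the boundary point $s + \tilde r e^{\mathbf{i}\phi}$. Optimal cuts applied sequentially to the clockwise corners: for $k \geq j$, given the boundary point $b_k = s + \tilde r e^{\mathbf{i}\phi_k}$, $\phi_k = \operatorname{Arg}(b_k - s)$, let $c_k = L_0 \cap L_{-\phi_k}$ be the corner of the polygonal outer approximation between $b_\star$ and $b_k$. Let $d_k = b_k - \mathbf{i}t_k e^{\mathbf{i}\phi_k}$, the point on $L_{-\phi_k}$ of modulus $r$ that is closest to $c_k$. The optimal cut of $c_k$ uses the supporting line of $W(M)$ through $d_k$ other than $L_{-\phi_k}$ (so that the new counter-clockwise corner, lying on $L_{-\phi_k}$, is $d_k$ and has modulus exactly $r$); this line touches $W(M)$ at the new boundary point $b_{k+1}$, and $\phi_{k+1} = \operatorname{Arg}(b_{k+1}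 - s)$. The next corner to be cut is $c_{k+1} = L_0 \cap L_{-\phi_{k+1}}$, and so on. A sequence $\{x_k\}$ with $x_k \neq x_\star$ converges to $x_\star$ Q-linearly with rate $q \in (0,1)$ if $x_k \to x_\star$ and $\lim_{k\to\infty} |x_{k+1} - x_\star|/|x_k - x_\star| = q$. *)

(* Defs.v *)
From HB Require Import structures.
From mathcomp Require Import all_boot all_order all_algebra.
From mathcomp Require Import all_classical all_reals all_analysis.
From mathcomp Require Import complex.
Import Order.TTheory GRing.Theory Num.Theory.
Import numFieldNormedType.Exports.

Set Implicit Arguments.
Unset Strict Implicit.
Unset Printing Implicit Defensive.

Local Open Scope classical_set_scope.
Local Open Scope ring_scope.
Local Open Scope complex_scope.
Local Open Scope sesquilinear_scope.

(* The norm `|z| of z : R[i] lives in R[i] (its imaginary part is 0), so moduli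
   are compared with reals embedded by _%:C; on R[i], x <= y and x < y moreover
   require x and y to have the same imaginary part. *)

Definition expi (R : realType) (theta : R) : R[i] := cos theta +i* sin theta.

Definition field_of_values (R : realType) (n : nat) (A : 'M[R[i]]_n) :
    set R[i] :=
  [set z | exists x : 'cV[R[i]]_n,
     (x ^t* *m x) 0 0 = 1 /\ z = (x ^t* *m A *m x) 0 0].

Definition rotated_hermitian_part (R : realType) (n : nat)
    (A : 'M[R[i]]_n) (theta : R) : 'M[R[i]]_n :=
  (2%:R)^-1 *: (expi theta *: A + expi (- theta) *: A ^t*).

(* The matrix is Hermitian, so all its eigenvalues are real; for n > 0 they form
   a finite nonempty set, whose sup is a maximum. *)
Definition lambda_max (R : realType) (n : nat) (A : 'M[R[i]]_n) (theta : R) :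
    R :=
  sup [set l : R | eigenvalue (rotated_hermitian_part A theta) l%:C].

Definition supporting_line (R : realType) (n : nat) (A : 'M[R[i]]_n)
    (theta : R) : set R[i] :=
  [set z | exists t : R,
     z = expi (- theta) * (lambda_max A theta +i* t)].

(* phi = Arg z; this determines phi as soon as z != 0. *)
Definition is_Arg (R : realType) (z : R[i]) (phi : R) : Prop :=
  - pi < phi <= pi /\ z = `|z| * expi phi.

(* One optimal cut: b is the current boundary point, of angle phi around the
   center s of the disk, c is the corner being cut, d = b - i t e^(i phi) is the
   new counter-clockwise corner, and b' is the new boundary point. *)
Record optimal_cut (R : realType) (n : nat) (A : 'M[R[i]]_n) (s r phi t : R)
    (b c d b' : R[i]) : Prop := OptimalCut {
  cut_angle : is_Arg (b - s%:C) phi;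
  cut_corner : supporting_line A 0 `&` supporting_line A (- phi) = [set c];
  cut_offset : d = b - (0 +i* t) * expi phi;
  cut_on_line : supporting_line A (- phi) d;
  cut_modulus : `|d| = r%:C;
  cut_closest : forall z : R[i], supporting_line A (- phi) z ->
    `|z| = r%:C -> `|d - c| <= `|z - c|;
  cut_touch : exists theta : R,
    [/\ supporting_line A theta d,
        supporting_line A theta <> supporting_line A (- phi) &
        supporting_line A theta `&` field_of_values A = [set b']]
}.

Definition Q_linear_cvg (R : realType) (x : nat -> R) (xstar q : R) : Prop :=
  [/\ 0 < q < 1,
      forall k : nat, x k != xstar,
      x k @[k --> \oo] --> xstar &
      `|x k.+1 - xstar| / `|x k - xstar| @[k --> \oo] --> q].

(* Main.v *)
(* The set W(M) is the disk |z - s| <= rt, so its support function in the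
   direction e^(-ia) is s cos a + rt; this is the largest eigenvalue of the
   rotated Hermitian part H because a maximizer x of x^*Hx is an isotropic
   vector of the positive semidefinite matrix l - H, hence in its kernel.
   On the line L_(-phi), |d| = r is a quadratic equation in t, and being closest
   to the corner selects its larger root.  The two contact points of the tangents
   through d are symmetric about the line joining s to d, each at the angle
   atan (t / rt) from it, so phi' = phi - 2 atan (t / rt).  Half-angle formulas
   factor t = 2 sin(phi/2) g(phi) with g smooth and positive, so this
   map of phi is smooth, sends (0, pi/2) into itself below the diagonal, and has
   derivative 1 - 2 g(0) / rt at its fixed point 0, which is the rate. *)

Require Import Defs.
From HB Require Import structures.
From mathcomp Require Import all_boot all_order all_algebra.
From mathcomp Require Import all_classical all_reals all_analysis.
From mathcomp Require Import complex ring lra.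
Import Order.TTheory GRing.Theory Num.Theory.
Import numFieldNormedType.Exports.

Local Open Scope classical_set_scope.
Local Open Scope ring_scope.
Local Open Scope complex_scope.

(** * Positive semidefinite Hermitian forms over a closed field *)

Section PositiveForms.
Local Open Scope sesquilinear_scope.
Variable C : numClosedFieldType.

Definition sesq n (B : 'M[C]_n) (x y : 'cV[C]_n) : C :=
  (x ^t* *m B *m y) 0 0.
Arguments sesq {n} B x y.

Lemma trmxC_mul m n p (A : 'M[C]_(m, n)) (B : 'M[C]_(n, p)) :
  (A *m B) ^t* = B ^t* *m A ^t*.
Proof. by rewrite trmx_mul map_mxM. Qed.

Lemma trmxCD m n (A B : 'M[C]_(m, n)) : (A + B) ^t* = A ^t* + B ^t*.
Proof. by rewrite linearD /= map_mxD. Qed.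

Lemma trmxCZ m n (a : C) (A : 'M[C]_(m, n)) : (a *: A) ^t* = a^*%R *: A ^t*.
Proof. by rewrite linearZ /= map_mxZ. Qed.

Lemma sesqDl n (B : 'M[C]_n) x x' y :
  sesq B (x + x') y = sesq B x y + sesq B x' y.
Proof. by rewrite /sesq trmxCD !mulmxDl mxE. Qed.

Lemma sesqDr n (B : 'M[C]_n) x y y' :
  sesq B x (y + y') = sesq B x y + sesq B x y'.
Proof. by rewrite /sesq mulmxDr mxE. Qed.

Lemma sesqZl n (B : 'M[C]_n) a x y : sesq B (a *: x) y = a^*%R * sesq B x y.
Proof. by rewrite /sesq trmxCZ -!scalemxAl mxE. Qed.

Lemma sesqZr n (B : 'M[C]_n) a x y : sesq B x (a *: y) = a * sesq B x y.
Proof. by rewrite /sesq -scalemxAr mxE. Qed.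

Lemma sesq_mxD n (A B : 'M[C]_n) x y :
  sesq (A + B) x y = sesq A x y + sesq B x y.
Proof. by rewrite /sesq mulmxDr mulmxDl mxE. Qed.

Lemma sesq_mxZ n a (A : 'M[C]_n) x y :
  sesq (a *: A) x y = a * sesq A x y.
Proof. by rewrite /sesq -scalemxAr -scalemxAl mxE. Qed.

Lemma sesq_scalar n (a : C) (x y : 'cV[C]_n) :
  sesq a%:M x y = a * (x ^t* *m y) 0 0.
Proof. by rewrite /sesq mul_mx_scalar -scalemxAl mxE. Qed.

Lemma sesq_adj n (B : 'M[C]_n) x y : sesq (B ^t*) x y = (sesq B y x)^*%R.
Proof.
have -> : (sesq B y x)^*%R = ((y ^t* *m B *m x) ^t*) 0 0.
  by rewrite /sesq [in RHS]mxE [in RHS]mxE.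
by rewrite /sesq !trmxC_mul trmxCK mulmxA.
Qed.

Lemma sqnorm_ge0 n (x : 'cV[C]_n) : 0 <= (x ^t* *m x) 0 0.
Proof.
by rewrite mxE; apply: sumr_ge0 => i _; rewrite !mxE mulrC mul_conjC_ge0.
Qed.

Lemma sqnorm_eq0 n (x : 'cV[C]_n) : (x ^t* *m x) 0 0 = 0 -> x = 0.
Proof.
rewrite mxE => /eqP; rewrite psumr_eq0; last first.
  by move=> i _; rewrite !mxE mulrC mul_conjC_ge0.
move=> /allP x0; apply/colP => i; rewrite mxE; apply/eqP.
by have := x0 i (mem_index_enum i); rewrite /= !mxE mulrC mul_conjC_eq0.
Qed.

(** Moving from an isotropic [x] a little way against [B *m x] would make the form negative, unless
    [B *m x] is zero. *)
Lemma psd_isotropic_ker n (B : 'M[C]_n) (x : 'cV[C]_n) :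
    B ^t* = B -> (forall y, 0 <= sesq B y y) -> sesq B x x = 0 ->
  B *m x = 0.
Proof.
move=> Bh Bge0 x0; apply: sqnorm_eq0.
set y := B *m x; set N := (y ^t* *m y) 0 0; set P := sesq B y y.
have N0 : 0 <= N := sqnorm_ge0 _ _.
have P0 : 0 <= P := Bge0 y.
have yx : sesq B y x = N by rewrite /sesq -mulmxA.
have xy : sesq B x y = N.
  by rewrite -[in LHS]Bh sesq_adj yx; apply/CrealP; rewrite ger0_real.
have P1 : 0 < P + 1 by rewrite ltr_wpDl.
(* The minimizer of the quadratic in [e] would be [- N / P]; dividing by [P + 1] avoids the case
   [P = 0] and still gives a value that is negative unless [N = 0]. *)
set e := - (N / (P + 1)).
have er : e^*%R = e by apply/CrealP; rewrite rpredN ger0_real// divr_ge0// ltW.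
(* The form is nonnegative along x + e y, where its linear term is 2 e |Bx|^2. *)
have := Bge0 (x + e *: y).
rewrite sesqDl !sesqDr !sesqZl !sesqZr er x0 xy yx -/P.
have -> : 0 + e * N + (e * N + e * (e * P)) =
    - (N ^+ 2 * (P + 2) / (P + 1) ^+ 2).
  by rewrite /e; field; rewrite lt0r_neq0.
rewrite oppr_ge0 => le0; apply/eqP.
have ge0 : 0 <= N ^+ 2 * (P + 2) / (P + 1) ^+ 2.
  by rewrite !(divr_ge0, mulr_ge0, exprn_ge0, addr_ge0).
have /eqP : N ^+ 2 * (P + 2) / (P + 1) ^+ 2 = 0 by apply: le_anti; rewrite le0.
rewrite !mulf_eq0 invr_eq0 !expf_eq0 /= (gt_eqF P1) orbF.
have -> := gt_eqF (ltr_wpDl P0 (ltr0n C 2)).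
by rewrite ?orbF orbb.
Qed.

(** Passes from arbitrary nonzero vectors to the unit vectors that make up the field of values. *)
Lemma normalize_vector n (x : 'cV[C]_n) : x != 0 ->
  exists2 u : 'cV[C]_n, (u ^t* *m u) 0 0 = 1 &
    forall B, sesq B x x = (x ^t* *m x) 0 0 * sesq B u u.
Proof.
move=> x0; set N := (x ^t* *m x) 0 0.
have N0 : 0 < N.
  rewrite lt_def sqnorm_ge0 andbT; apply: contra_neq x0; exact: sqnorm_eq0.
have a0 : 0 < sqrtC N by rewrite sqrtC_gt0.
have ar : ((sqrtC N)^-1)^*%R = (sqrtC N)^-1.
  by apply/CrealP; rewrite realV gtr0_real.
exists ((sqrtC N)^-1 *: x) => [|B].
  rewrite trmxCZ ar -scalemxAl -scalemxAr mxE [X in _ * X]mxE -/N.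
  rewrite mulrA -expr2 exprVn sqrtCK.
  by rewrite mulVf// gt_eqF.
rewrite sesqZl sesqZr ar !mulrA -{1}(sqrtCK N); field.
by rewrite gt_eqF.
Qed.

End PositiveForms.
Arguments sesq {C n} B x y.

(** * The largest eigenvalue of the rotated Hermitian part as a support function *)

Section LargestEigenvalue.
Local Open Scope sesquilinear_scope.
Variables (R : realType) (n : nat) (A : 'M[R[i]]_n).

Lemma conj_expi (a : R) : ((expi a)^*)%R = expi (- a).
Proof. by rewrite /expi cosN sinN. Qed.

Lemma conj_real_complex (a : R) : ((a%:C)^*)%R = a%:C.
Proof. exact: conjc_real. Qed.

Lemma field_of_valuesE z : field_of_values A z <->
  exists2 x : 'cV[R[i]]_n, (x ^t* *m x) 0 0 = 1 & z = sesq A x x.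
Proof. by split=> [[x [x1 ->]]|[x x1 ->]]; exists x. Qed.

Lemma rotated_hermitian_part_adj a :
  (rotated_hermitian_part A a) ^t* = rotated_hermitian_part A a.
Proof.
rewrite /rotated_hermitian_part trmxCZ trmxCD !trmxCZ trmxCK !conj_expi opprK.
by rewrite [X in _ *: X = _]addrC fmorphV rmorph_nat.
Qed.

Lemma sesq_rotated_hermitian_part a x :
  sesq (rotated_hermitian_part A a) x x =
  (complex.Re (expi a * sesq A x x))%:C.
Proof.
rewrite sesq_mxZ sesq_mxD !sesq_mxZ sesq_adj -conj_expi -rmorphM /= ReJ_add.
by rewrite mulrC.
Qed.

(** The maximizing unit vector shows that [l] is an eigenvalue; conversely, every eigenvalue is the
    value of the form at a unit eigenvector, hence at most [l]. *)
Lemma lambda_maxE a l :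
    (exists2 z, field_of_values A z & complex.Re (expi a * z) = l) ->
    (forall z, field_of_values A z -> complex.Re (expi a * z) <= l) ->
  lambda_max A a = l.
Proof.
move=> [_ /field_of_valuesE[x x1 ->] xl] lub.
set H := rotated_hermitian_part A a.
have lE : eigenvalue H l%:C.
  (* [eigenvalue] is about row vectors, so the kernel column [x] is turned into a row by the
     adjoint, which fixes [H]. *)
  apply/eigenvalueP; exists (x ^t*); last first.
    apply/eqP => x0; move: x1; rewrite x0 mul0mx mxE => /esym/eqP.
    by rewrite oner_eq0.
  have : (l%:C%:M - H) *m x = 0.
    apply: psd_isotropic_ker.
    - rewrite trmxCD linearN /= map_mxN rotated_hermitian_part_adj.
      rewrite tr_scalar_mx map_scalar_mx; congr (_%:M - _).
      exact: conj_real_complex.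
    - move=> y; have [->|y0] := eqVneq y 0.
        by rewrite /sesq mulmx0 mxE lexx.
      have [u u1 ->] := normalize_vector _ _ _ y0.
      rewrite mulr_ge0 ?sqnorm_ge0// sesq_mxD -scaleN1r sesq_mxZ mulN1r.
      rewrite sesq_scalar u1 mulr1 sesq_rotated_hermitian_part -rmorphB ler0c.
      by rewrite subr_ge0 lub//; apply/field_of_valuesE; exists u.
    - rewrite sesq_mxD -scaleN1r sesq_mxZ mulN1r.
      by rewrite sesq_scalar x1 mulr1 sesq_rotated_hermitian_part xl subrr.
  rewrite mulmxBl => /subr0_eq; rewrite mul_scalar_mx => /esym Hx.
  by rewrite -[H]rotated_hermitian_part_adj -trmxC_mul Hx trmxCZ ?conj_real_complex.
have ubl : ubound [set l0 | eigenvalue H l0%:C] l.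
  move=> m /= /eigenvalueP[v vH v0].
  have Hv : H *m v ^t* = m%:C *: v ^t*.
    by rewrite -[H]rotated_hermitian_part_adj -trmxC_mul vH trmxCZ ?conj_real_complex.
  have w0 : v ^t* != 0.
    apply: contra_neq v0 => v0.
    by rewrite -[v]trmxCK v0 linear0 map_mx0.
  have [u u1 uE] := normalize_vector _ _ _ w0.
  set N := (_ *m v ^t*) 0 0 in uE.
  have N0 : N != 0 by apply: contra_neq w0; exact: sqnorm_eq0.
  have : sesq H (v ^t*) (v ^t*) = m%:C * N.
    by rewrite /sesq -mulmxA Hv -scalemxAr mxE.
  rewrite uE mulrC => /(mulIf N0); rewrite sesq_rotated_hermitian_part.
  by case=> <-; apply: lub; apply/field_of_valuesE; exists u.
apply/eqP; rewrite eq_le; apply/andP; split.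
  by apply: ge_sup => //; exists l.
by apply: ub_le_sup => //; exists l.
Qed.

End LargestEigenvalue.

(** * The optimal cut as a smooth map of the angle *)

Section CutMap.
Variables (R : realType) (s rt : R).
Hypotheses (s_gt0 : 0 < s) (rt_gt0 : 0 < rt).

(* The factor g of the offset t = 2 sin(phi/2) g(phi). *)
Definition cut_gap (x : R) : R :=
  Num.sqrt (s ^+ 2 * cos (x / 2) ^+ 2 + s * rt) - s * cos (x / 2).

Definition cut_offset (x : R) : R := 2 * sin (x / 2) * cut_gap x.

Definition cut_map (x : R) : R := x - 2 * atan (cut_offset x / rt).

Lemma radicand_gt0 x : 0 < s ^+ 2 * cos (x / 2) ^+ 2 + s * rt.
Proof. by rewrite ltr_wpDl ?mulr_gt0// -exprMn sqr_ge0. Qed.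

Lemma cut_gap_gt0 x : 0 < cut_gap x.
Proof.
rewrite subr_gt0; have [c0|c0] := lerP (s * cos (x / 2)) 0.
  by rewrite (le_lt_trans c0)// sqrtr_gt0 radicand_gt0.
rewrite -ltr_sqr ?nnegrE ?sqrtr_ge0 1?ltW// sqr_sqrtr ?ltW ?radicand_gt0//.
by rewrite exprMn ltrDl mulr_gt0.
Qed.

Lemma doubled_half (x : R) : x / 2 *+ 2 = x.
Proof. by rewrite -mulr_natr mulfVK// pnatr_eq0. Qed.

Lemma cos_half (x : R) : cos x = 1 - 2 * sin (x / 2) ^+ 2.
Proof.
rewrite -[in LHS](doubled_half x) cos_mulr2n cos2sin2 -mulr_natl; ring.
Qed.

Lemma sin_half (x : R) : sin x = 2 * sin (x / 2) * cos (x / 2).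
Proof.
rewrite -[in LHS](doubled_half x) sin_mulr2n -mulr_natl; ring.
Qed.

(** By the half-angle formulas the radicand is [(2 * sin (x / 2)) ^+ 2] times that of [cut_gap]; the
    sign hypothesis lets this square leave the root without an absolute value. *)
Lemma cut_offsetE x : 0 <= sin (x / 2) ->
  cut_offset x = - s * sin x
    + Num.sqrt (s ^+ 2 * sin x ^+ 2 + 2 * s * rt * (1 - cos x)).
Proof.
move=> u0; rewrite /cut_offset /cut_gap (sin_half x) (cos_half x).
set u := sin _ in u0 *; set w := cos _.
have -> : s ^+ 2 * (2 * u * w) ^+ 2 + 2 * s * rt * (1 - (1 - 2 * u ^+ 2)) =
    (2 * u) ^+ 2 * (s ^+ 2 * w ^+ 2 + s * rt) by ring.
rewrite sqrtrM ?sqr_ge0// sqrtr_sqr ger0_norm ?mulr_ge0//; ring.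
Qed.

Lemma half_bounds (x : R) : 0 < x < pi / 2 -> 0 < x / 2 < pi / 2.
Proof. by move=> /andP[x0 xpi]; lra. Qed.

Lemma cut_offset_gt0 x : 0 < x < pi / 2 -> 0 < cut_offset x.
Proof.
move=> /half_bounds xb; rewrite mulr_gt0 ?cut_gap_gt0// mulr_gt0//.
exact: sin_gt0_pihalf.
Qed.

(** This keeps the new angle positive. Once denominators are cleared, the two sides of the remaining
    inequality have squares that differ by exactly [rt ^+ 2]. *)
Lemma cut_offset_lt x : 0 < x < pi / 2 -> cut_offset x / rt < tan (x / 2).
Proof.
move=> /half_bounds xb; have u0 := sin_gt0_pihalf xb.
have w0 : 0 < cos (x / 2) by apply: cos_gt0_pihalf; lra.
rewrite /tan /cut_offset ltr_pdivrMr// -[ltRHS]mulrAC -mulrA ltr_pdivlMr//.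
rewrite [2 * _]mulrC -!mulrA ltr_pM2l// /cut_gap; set w := cos _ in w0 *.
suff : 2 * w * Num.sqrt (s ^+ 2 * w ^+ 2 + s * rt) < rt + 2 * s * w ^+ 2.
  by move=> h; lra.
have q0 : 0 < rt + 2 * s * w ^+ 2.
  by rewrite addr_gt0 ?mulr_gt0 ?exprn_gt0.
rewrite -ltr_sqr ?nnegrE ?mulr_ge0 ?sqrtr_ge0 1?ltW// exprMn sqr_sqrtr; last first.
  exact/ltW/radicand_gt0.
have := exprn_gt0 2 rt_gt0; nra.
Qed.

Lemma cut_map_bounds x : 0 < x < pi / 2 -> 0 < cut_map x < x.
Proof.
move=> xb; have t0 := cut_offset_gt0 _ xb; have := cut_offset_lt _ xb.
have {xb}/andP[x0 xpi] := half_bounds _ xb.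
move=> /lt_atan; rewrite tanK ?in_itv/= => [a2|]; last by lra.
have a1 : 0 < atan (cut_offset x / rt).
  by rewrite -(@atan0 R) lt_atan ?divr_gt0.
by rewrite /cut_map; lra.
Qed.

(** With [a = atan (t / rt)], the quotient is [tan (x - a)] by the subtraction formulas, and [x - a]
    lies in the range where [atan] inverts [tan]; finally [- x + 2 * (x - a) = x - 2 * a]. *)
Lemma cut_map_tanE x : 0 < x < pi / 2 -> let t := cut_offset x in
  cut_map x = - x
    + 2 * atan ((rt * sin x - t * cos x) / (rt * cos x + t * sin x)).
Proof.
move=> xb t; have /andP[x0 xpi] := xb.
have /andP[m0 mx] := cut_map_bounds _ xb.
rewrite /cut_map in m0 mx *; rewrite -/t in m0 mx *.
set a := atan (t / rt) in m0 mx *.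
have ca : 0 < cos a by apply: cos_gt0_pihalf; rewrite atan_gtNpi2 atan_ltpi2.
have rt0 := lt0r_neq0 rt_gt0.
have sa : rt * sin a = t * cos a.
  have : tan a = t / rt by rewrite atanK.
  rewrite /tan => /(congr1 ( *%R^~ (cos a * rt))).
  by rewrite mulrA divfK ?gt_eqF// mulrC => ->; field.
have -> : (rt * sin x - t * cos x) / (rt * cos x + t * sin x) = tan (x - a).
  have h : 0 < cos (x - a) by apply: cos_gt0_pihalf; lra.
  have sE : rt * sin x - t * cos x = rt / cos a * sin (x - a).
    apply: (mulIf (lt0r_neq0 ca)).
    rewrite sinB mulrBl -[t * cos x * _]mulrAC -sa; field.
    exact: lt0r_neq0.
  have cE : rt * cos x + t * sin x = rt / cos a * cos (x - a).
    apply: (mulIf (lt0r_neq0 ca)).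
    rewrite cosB mulrDl -[t * sin x * _]mulrAC -sa; field.
    exact: lt0r_neq0.
  rewrite sE cE /tan; field.
  by rewrite rt0 !lt0r_neq0.
rewrite tanK ?in_itv/=; lra.
Qed.

Lemma is_derive_half (x : R) : is_derive x 1 (fun y : R => y / 2) (2^-1).
Proof. by apply: is_derive_eq; rewrite ?mulr1 ?scaler0 ?add0r ?scaler1. Qed.

Lemma is_derive_half_comp (f : R -> R) (x df : R) :
  is_derive (x / 2) 1 f df -> is_derive x 1 (fun y => f (y / 2)) (df / 2).
Proof.
move=> fd; exact: (@is_derive1_comp _ f (fun y : R => y / 2) x _ _ fd
  (is_derive_half x)).
Qed.

(** Existence is enough: at 0 this derivative enters that of [cut_offset] with the factor
    [sin 0]. *)
Lemma ex_is_derive_cut_gap (x : R) : exists df : R, is_derive x 1 cut_gap df.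
Proof.
have dw := is_derive_half_comp _ _ _ (is_derive_cos (x / 2)).
set w := fun y : R => cos (y / 2) in dw.
pose rad : R -> R := s ^+ 2 *: (w * w) + cst (s * rt).
have radE y : rad y = s ^+ 2 * cos (y / 2) ^+ 2 + s * rt by rewrite expr2.
have rad0 : 0 < rad x by rewrite radE radicand_gt0.
have drad : derivable rad x 1 by exact: ex_derive.
have dr := @is_derive1_comp _ _ rad x _ _ (is_derive1_sqrt rad0) (derivableP drad).
eexists; have -> : cut_gap = (Num.sqrt \o rad) - s *: w.
  by apply/funext => y; rewrite /cut_gap -radE.
exact: is_deriveB.
Qed.

Lemma is_derive_cut_offset (x : R) : exists2 dg : R,
  is_derive x 1 cut_gap dg &
  is_derive x 1 cut_offset (cos (x / 2) * cut_gap x + 2 * sin (x / 2) * dg).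
Proof.
have [dg gd] := ex_is_derive_cut_gap x; exists dg => //.
have dv := is_derive_half_comp _ _ _ (is_derive_sin (x / 2)).
set v := fun y : R => sin (y / 2) in dv.
have -> : cut_offset = (2 *: v) * cut_gap by [].
by apply: is_derive_eq; rewrite /GRing.scale /= /v /GRing.scale /=; field.
Qed.

Lemma is_derive_cut_map (x : R) : exists2 dt : R, is_derive x 1 cut_offset dt &
  is_derive x 1 cut_map
    (1 - 2 * (1 + (cut_offset x / rt) ^+ 2)^-1 * (dt / rt)).
Proof.
have [dg _ dt] := is_derive_cut_offset x; eexists; first exact: dt.
have dq := is_deriveZ rt^-1 dt.
have da := @is_derive1_comp _ atan _ x _ _ (is_derive1_atan _) dq.
have -> : cut_map = id - 2 *: (atan \o (rt^-1 *: cut_offset)).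
  by apply/funext => y; rewrite /cut_map [cut_offset y / rt]mulrC.
apply: is_derive_eq; rewrite /GRing.scale /= /GRing.scale /=.
by rewrite [cut_offset x / rt]mulrC; ring.
Qed.

Lemma continuous_cut_map : continuous cut_map.
Proof.
move=> x; have [dt _ dm] := is_derive_cut_map x.
by apply/differentiable_continuous/derivable1_diffP; exact: ex_derive.
Qed.

Lemma is_derive0_cut_map :
  is_derive (0 : R) 1 cut_map (1 - 2 * (Num.sqrt (s * (s + rt)) - s) / rt).
Proof.
have [dg _ d0] := is_derive_cut_offset 0.
have [dt dt0] := is_derive_cut_map 0.
have -> : dt = Num.sqrt (s * (s + rt)) - s.
  rewrite -(@derive_val _ _ _ _ _ _ _ dt0) (@derive_val _ _ _ _ _ _ _ d0).
  rewrite /cut_gap mul0r sin0 cos0 mulr0 mul0r addr0 mul1r mulr1.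
  by rewrite expr1n mulr1 mulrDr expr2.
rewrite /cut_offset mul0r sin0 mulr0 !mul0r expr0n addr0 invr1 mulr1.
by rewrite mulrA.
Qed.

Lemma cut_map0 : cut_map 0 = 0.
Proof.
by rewrite /cut_map /cut_offset mul0r sin0 mulr0 !mul0r atan0 mulr0 subr0.
Qed.

(** * Orbits of the cut map: convergence to 0 and limit ratio *)

Variable u : nat -> R.
Hypotheses (u0 : 0 < u 0%N < pi / 2) (uS : forall k, u k.+1 = cut_map (u k)).

Lemma cut_orbit_bounds k : 0 < u k < pi / 2.
Proof.
elim: k => // k IHk; rewrite uS; have := cut_map_bounds _ IHk.
by case/andP: IHk => _ h /andP[-> /lt_trans->].
Qed.

(** A decreasing orbit bounded below converges to a fixed point, and the map is strictly below the
    diagonal on the open interval. *)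
Lemma cut_orbit_cvg0 : u k @[k --> \oo] --> 0.
Proof.
have unon : nonincreasing_seq u.
  apply/nonincreasing_seqP => k; rewrite uS.
  by have /andP[_ /ltW] := cut_map_bounds _ (cut_orbit_bounds k).
have ulb : has_lbound (range u).
  by exists 0 => _ [k _ <-]; case/andP: (cut_orbit_bounds k) => /ltW.
have ucv := nonincreasing_is_cvgn unon ulb.
set l := limn u in ucv *.
have l0 : 0 <= l.
  by apply: limr_ge => //; near=> k; case/andP: (cut_orbit_bounds k) => /ltW.
(* The strict bound comes from [u 0], which dominates the limit. *)
have lpi : l < pi / 2.
  have := nonincreasing_cvgn_ge unon ucv 0%N; case/andP: u0 => _ h /le_lt_trans.
  exact.
have lfix : cut_map l = l.
  have c1 : cut_map (u k) @[k --> \oo] --> cut_map l.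
    exact: (cvg_comp _ _ ucv (continuous_cut_map l)).
  have c2 : cut_map (u k) @[k --> \oo] --> l.
    rewrite -(_ : (fun k => u k.+1) = fun k => cut_map (u k)); last first.
      by apply/funext => k; rewrite uS.
    by rewrite (cvg_shiftS u).
  exact: (cvg_unique _ c1 c2).
have [<-//|l_neq0] := eqVneq l 0.
have /cut_map_bounds : 0 < l < pi / 2 by rewrite lt_def l_neq0 l0.
by rewrite lfix ltxx andbF.
Unshelve. all: by end_near. Qed.

(** Since 0 is fixed, the ratio is the difference quotient of [cut_map] at 0 with increment [u k],
    which is nonzero and tends to 0. *)
Lemma cut_orbit_ratio_cvg :
  u k.+1 / u k @[k --> \oo] --> 1 - 2 * (Num.sqrt (s * (s + rt)) - s) / rt.
Proof.
have [dm dmE] := is_derive0_cut_map; rewrite -dmE.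
have /cvgr_dnbhsP/(_ u) := dm.
have -> : (fun k => u k.+1 / u k) =
    (fun k => (u k)^-1 *: (cut_map (u k *: 1 + 0) - cut_map 0)).
  apply/funext => k; rewrite cut_map0 subr0 addr0 uS mulrC.
  by rewrite /GRing.scale /= mulr1.
apply; split; last exact: cut_orbit_cvg0.
by move=> k; case/andP: (cut_orbit_bounds k) => /lt0r_neq0.
Qed.

End CutMap.

(** * Tangent lines and optimal cuts when the field of values is a disk *)

Section DiskFieldOfValues.
Variable R : realType.
Implicit Types (z w : R[i]) (a : R).

Lemma normc_sqr z a : 0 <= a ->
  (`|z| == a%:C) = (complex.Re z ^+ 2 + complex.Im z ^+ 2 == a ^+ 2).
Proof.
move=> a0; rewrite normc_def (inj_eq (@complexI _)).
by rewrite -(eqrXn2 (ltn0Sn 1)) ?sqrtr_ge0// sqr_sqrtr// addr_ge0 ?sqr_ge0.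
Qed.

Lemma normc_le_sqr z a : 0 <= a ->
  (`|z| <= a%:C) = (complex.Re z ^+ 2 + complex.Im z ^+ 2 <= a ^+ 2).
Proof.
move=> a0; rewrite normc_def lecR -ler_sqr ?nnegrE ?sqrtr_ge0//.
by rewrite sqr_sqrtr// addr_ge0 ?sqr_ge0.
Qed.

Lemma normc_le_normc z w : (`|z| <= `|w|) =
  (complex.Re z ^+ 2 + complex.Im z ^+ 2
    <= complex.Re w ^+ 2 + complex.Im w ^+ 2).
Proof.
rewrite [`|w|]normc_def normc_le_sqr ?sqrtr_ge0// sqr_sqrtr//.
by rewrite addr_ge0 ?sqr_ge0.
Qed.

Lemma expi_unit a : `|expi a| = 1.
Proof. by rewrite normc_def /= cos2Dsin2 sqrtr1. Qed.

Lemma field_of_values_affine n (K : 'M[R[i]]_n) (s rt : R) z : rt != 0 ->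
  field_of_values ((s%:C)%:M + rt%:C *: K) z <->
  field_of_values K ((z - s%:C) / rt%:C).
Proof.
move=> rt0; have rtC : rt%:C != 0 by rewrite (inj_eq (@complexI _) rt 0).
split=> /field_of_valuesE[x x1 zE]; apply/field_of_valuesE; exists x => //.
  rewrite zE sesq_mxD sesq_mxZ sesq_scalar x1 mulr1 addrAC subrr add0r.
  by rewrite mulrC mulKf.
rewrite sesq_mxD sesq_mxZ sesq_scalar x1 mulr1 -zE.
by rewrite mulrC divfK// addrC subrK.
Qed.

Variables (n : nat) (A : 'M[R[i]]_n) (s rt : R).
Hypothesis rt_gt0 : 0 < rt.
Hypothesis WA : forall z, field_of_values A z <-> `|z - s%:C| <= rt%:C.

Lemma lambda_max_disk a : lambda_max A a = s * cos a + rt.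
Proof.
apply: lambda_maxE.
  exists (s%:C + rt%:C * expi (- a)).
    apply/WA; rewrite addrAC subrr add0r normrM expi_unit mulr1.
    by rewrite ger0_norm// ler0c ltW.
  rewrite /= cosN sinN; have := cos2Dsin2 a.
  move: (cos a) (sin a) => c d cd.
  by transitivity (s * c + rt * (c ^+ 2 + d ^+ 2)); [ring | rewrite cd mulr1].
move=> [x y] /WA; rewrite (normc_le_sqr _ _ (ltW rt_gt0)) /= subr0 => zd.
have := cos2Dsin2 a; move: (cos a) (sin a) => c d cd.
have h : c * (x - s) - d * y <= rt.
  have [h0|h] := lerP (c * (x - s) - d * y) 0.
    exact: le_trans h0 (ltW rt_gt0).
  rewrite -ler_sqr ?nnegrE ?(ltW h) ?(ltW rt_gt0)//; apply: le_trans zd.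
  rewrite -subr_ge0.
  (* Lagrange's identity, which yields Cauchy-Schwarz against the unit vector [(c, - d)]. *)
  have -> : (x - s) ^+ 2 + y ^+ 2 - (c * (x - s) - d * y) ^+ 2 =
      ((x - s) * d + y * c) ^+ 2
      + ((x - s) ^+ 2 + y ^+ 2) * (1 - (c ^+ 2 + d ^+ 2)) by ring.
  by rewrite cd subrr mulr0 addr0 sqr_ge0.
rewrite -lerBlDl; apply: le_trans h; rewrite le_eqVlt.
by apply/orP; left; apply/eqP; ring.
Qed.

Lemma supporting_line_diskE a z : supporting_line A a z <->
  cos a * complex.Re z - sin a * complex.Im z = s * cos a + rt.
Proof.
have cd := cos2Dsin2 a; split=> [[t ->]|].
  rewrite lambda_max_disk /= cosN sinN.
  move: (cos a) (sin a) cd => c d cd.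
  transitivity ((s * c + rt) * (c ^+ 2 + d ^+ 2)); first by ring.
  by rewrite cd mulr1.
case: z => x y /= h.
(* The parameter is the imaginary part of [expi a * z]. *)
exists (sin a * x + cos a * y); rewrite lambda_max_disk -h /expi cosN sinN.
move: (cos a) (sin a) cd => c d cd.
apply/eqP; rewrite eq_complex /=; apply/andP; split; apply/eqP.
  transitivity (x * (c ^+ 2 + d ^+ 2)); [by rewrite cd mulr1|ring].
transitivity (y * (c ^+ 2 + d ^+ 2)); [by rewrite cd mulr1|ring].
Qed.

Lemma touching_point a b :
  supporting_line A a `&` field_of_values A = [set b] ->
  b = s%:C + rt%:C * expi (- a).
Proof.
move=> /seteqP[sub _]; apply/esym/sub; split.
  apply/supporting_line_diskE; rewrite /= cosN sinN; have := cos2Dsin2 a.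
  move: (cos a) (sin a) => c d cd.
  by transitivity (s * c + rt * (c ^+ 2 + d ^+ 2)); [ring | rewrite cd mulr1].
apply/WA; rewrite addrAC subrr add0r normrM expi_unit mulr1.
by rewrite ger0_norm// ler0c ltW.
Qed.

(** Only cosines and sines are compared, because [a] may lie outside the range of the argument. *)
Lemma is_Arg_circle a phi : is_Arg (rt%:C * expi a) phi ->
  cos phi = cos a /\ sin phi = sin a.
Proof.
move=> [_]; rewrite normrM expi_unit mulr1 ger0_norm ?ler0c ?ltW// => /eqP.
rewrite (inj_eq (mulfI _)); last by rewrite (inj_eq (@complexI _) rt 0) gt_eqF.
by rewrite eq_complex /= => /andP[/eqP-> /eqP->].
Qed.

Lemma sin_eq0_bounded a : - pi < a < pi -> sin a = 0 -> a = 0.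
Proof.
move=> ab sa; have [a0|a0|//] := ltgtP a 0.
  have : 0 < sin (- a) by apply: sin_gt0_pi; lra.
  by rewrite sinN sa oppr0 ltxx.
have : 0 < sin a by apply: sin_gt0_pi; lra.
by rewrite sa ltxx.
Qed.

(** The equation says that [d] lies on the tangent at angle [psi]. With [e] half of [phi - psi], it
    reads [sin e * (t * cos e - rt * sin e) = 0]; the first factor belongs to the old tangent, so
    [tan e = t / rt]. *)
Lemma second_tangent_angle t phi psi : 0 < t -> 0 < phi < pi / 2 ->
    - pi < psi <= pi -> psi != phi ->
    rt * cos (phi - psi) + t * sin (phi - psi) = rt ->
  psi = phi - 2 * atan (t / rt).
Proof.
move=> t0 hphi hpsi neq; set e := (phi - psi) / 2.
have eE : phi - psi = e *+ 2 by rewrite /e doubled_half.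
have /andP[p0 p1] : 0 < phi < pi / 2 by [].
have /andP[q0 q1] : - pi < psi <= pi by [].
have eb : - (pi / 2) < e < pi by rewrite /e; apply/andP; split; lra.
have e0 : e != 0.
  by apply: contraNneq neq; rewrite /e => h; apply/eqP; lra.
have se0 : sin e != 0.
  apply: contra e0 => /eqP /sin_eq0_bounded e0; apply/eqP.
  by apply: e0; have := @pi_gt0 R; lra.
rewrite eE cos_mulr2n sin_mulr2n cos2sin2 => h.
have {h} sc : rt * sin e = t * cos e.
  by apply: (mulfI se0); move: h; rewrite !mulr2n; lra.
(* For negative [e] the range decides; for positive [e] the sine is positive and [sc] transfers its
   sign to the cosine. *)
have c0 : 0 < cos e.
  have [e_lt0|e_gt0|/eqP] := ltgtP e 0; last by rewrite (negPf e0).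
    by apply: cos_gt0_pihalf; have := @pi_gt0 R; lra.
  rewrite -(pmulr_rgt0 _ t0) -sc mulr_gt0// sin_gt0_pi// e_gt0.
  by case/andP: eb.
have ehalf : e < pi / 2.
  rewrite ltNge; apply/negP => ge; have : 0 <= - cos e; last by lra.
  by rewrite -sinBpihalf; apply: sin_ge0_pi; have := @pi_gt0 R; lra.
have -> : t = rt * tan e by rewrite /tan mulrA sc mulfK ?gt_eqF.
rewrite mulrAC divff ?gt_eqF// mul1r.
rewrite tanK; first by rewrite /e; lra.
by rewrite in_itv/= ehalf andbT; case/andP: eb.
Qed.

(** The record fixes only the angle of the current point, so the argument [phi'] of the new point is
    a separate hypothesis. *)
Lemma optimal_cut_map (r phi t : R) (b c d b' : R[i]) (phi' : R) :
    0 < s -> r = s + rt ->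
    0 < phi < pi / 2 -> b = s%:C + rt%:C * expi phi ->
    optimal_cut A s r phi t b c d b' -> is_Arg (b' - s%:C) phi' ->
  [/\ t = cut_offset R s rt phi, phi' = cut_map R s rt phi &
      b' = s%:C + rt%:C * expi phi'].
Proof.
move=> s0 rE phib bE [_ cE dE _ dr dclose [a [dl /= lneq b'E]]] phi'E.
have b'P := touching_point _ _ b'E.
have phi'a : expi phi' = expi (- a).
  have [] := is_Arg_circle (- a) phi'.
    by move: phi'E; rewrite b'P addrAC subrr add0r.
  by rewrite /expi => -> ->.
have u0 : 0 < sin phi by exact: sin_gt0_pihalf.
have [t_gt0 tS] : 0 < cut_offset R s rt phi /\ cut_offset R s rt phi =
  - s * sin phi + Num.sqrt (s ^+ 2 * sin phi ^+ 2 + 2 * s * rt * (1 - cos phi)).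
  split; first exact: cut_offset_gt0.
  apply: cut_offsetE; apply/ltW/sin_gt0_pihalf.
  exact: half_bounds.
have cd := cos2Dsin2 phi.
have r_ge0 : 0 <= r by rewrite rE addr_ge0 ?(ltW s0) ?(ltW rt_gt0).
(* Completing the square in the parameter [x] of the tangent exhibits the two roots. *)
have on_circle x : (`|b - (0 +i* x) * expi phi| == r%:C) =
    ((x + s * sin phi) ^+ 2
      == s ^+ 2 * sin phi ^+ 2 + 2 * s * rt * (1 - cos phi)).
  rewrite (normc_sqr _ _ r_ge0) bE rE /=.
  move: (cos phi) (sin phi) cd => w u cd.
  rewrite -subr_eq0 -[in RHS]subr_eq0; congr (_ == 0).
  transitivity ((x + s * u) ^+ 2 - (s ^+ 2 * u ^+ 2 + 2 * s * rt * (1 - w))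
    + (rt ^+ 2 + x ^+ 2) * (w ^+ 2 + u ^+ 2 - 1)); first by ring.
  by rewrite cd subrr mulr0 addr0.
have on_line x : supporting_line A (- phi) (b - (0 +i* x) * expi phi).
  apply/supporting_line_diskE; rewrite bE /= cosN sinN.
  move: (cos phi) (sin phi) cd => w u cd.
  by transitivity (s * w + rt * (w ^+ 2 + u ^+ 2)); [ring | rewrite cd mulr1].
set rad := s ^+ 2 * _ + _ in tS on_circle.
have cos_lt1 : cos phi < 1 by rewrite -(@cos0 R) ltr_cos ?in_itv/=; lra.
have rad0 : 0 < rad.
  apply: ltr_wpDl; first by rewrite mulr_ge0 ?sqr_ge0.
  by rewrite !mulr_gt0 ?subr_gt0.
have S0 : 0 < Num.sqrt rad by rewrite sqrtr_gt0.
have tE : t = cut_offset R s rt phi.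
  have : (t + s * sin phi) ^+ 2 = rad by apply/eqP; rewrite -on_circle -dE dr.
  rewrite -{1}(sqr_sqrtr (ltW rad0)) => /eqP.
  rewrite eqf_sqr => /orP[|] /eqP tE.
    by rewrite tS -tE; ring.
  (* The smaller root is farther from the corner, which lies at q > 0. *)
  exfalso; move: (cut_offset _ _ _ _) t_gt0 tS => o t_gt0 tS.
  have /seteqP[_ /(_ c erefl)[]] := cE.
  case: c {cE} dclose => p q dclose.
  move=> /supporting_line_diskE; rewrite /= cos0 sin0.
  rewrite mul1r mul0r subr0 mulr1 => pE.
  move=> /supporting_line_diskE; rewrite /= cosN sinN pE => qE.
  have {}qE : sin phi * q = rt * (1 - cos phi) by lra.
  (* The two tangent segments from the corner have equal length, so the corner has parameter [q] on
     the line. *)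
  have dist x : complex.Re (b - (0 +i* x) * expi phi - (p +i* q)) ^+ 2
      + complex.Im (b - (0 +i* x) * expi phi - (p +i* q)) ^+ 2 = (x - q) ^+ 2.
    rewrite bE /= pE; move: (cos phi) (sin phi) cd u0 qE => w u cd u0 qE.
    have wq : rt * u - q = w * q.
      apply: (mulfI (lt0r_neq0 u0)); rewrite mulrBr qE [u * (w * q)]mulrCA qE.
      transitivity (rt * (w ^+ 2 + u ^+ 2 - w ^+ 2) - rt * (1 - w)); first by ring.
      by rewrite cd; ring.
    transitivity ((x * u - rt * (1 - w)) ^+ 2 + (rt * u - q - x * w) ^+ 2).
      by congr (_ ^+ 2 + _ ^+ 2); ring.
    rewrite -qE wq; transitivity ((x - q) ^+ 2 * (w ^+ 2 + u ^+ 2)); first by ring.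
    by rewrite cd mulr1.
  have q0 : 0 < q by rewrite -(pmulr_rgt0 _ u0) qE mulr_gt0 ?subr_gt0.
  have : `|d - (p +i* q)| <= `|b - (0 +i* o) * expi phi - (p +i* q)|.
    apply: dclose; first exact: on_line.
    have oS : o + s * sin phi = Num.sqrt rad by rewrite tS; ring.
    by apply/eqP; rewrite on_circle oS (sqr_sqrtr (ltW rad0)).
  rewrite normc_le_normc dE !dist; apply/negP; rewrite -ltNge -subr_gt0.
  have -> : (t - q) ^+ 2 - (o - q) ^+ 2 =
      4 * Num.sqrt rad * (s * sin phi + q).
    by rewrite tS -[t](addrK (s * sin phi)) tE; ring.
  apply: mulr_gt0; first by rewrite pmulr_rgt0 ?ltr0n.
  exact: addr_gt0 (mulr_gt0 s0 u0) q0.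
split; [exact: tE | | by rewrite phi'a].
have phi'b : - pi < phi' <= pi by case: phi'E.
rewrite /cut_map -tE; rewrite -tE in t_gt0.
apply: (second_tangent_angle _ _ _ t_gt0 phib phi'b).
  (* Equal angles would make the two supporting lines coincide. *)
  apply/eqP => phi'phi; apply: lneq; move: phi'a; rewrite phi'phi => -[ca sa].
  apply/funext => z; apply/propext; split=> /supporting_line_diskE h;
    apply/supporting_line_diskE; move: h;
    by rewrite !(cosN, sinN) ca sa !(cosN, sinN, opprK).
move: phi'a => -[]; rewrite cosN sinN => ca sa.
move: dl => /supporting_line_diskE; rewrite dE bE /= cosB sinB -ca.
have -> : sin a = - sin phi' by rewrite sa opprK.
by move=> h; lra.
Qed.

End DiskFieldOfValues.

(** * The rate in terms of [mu], and the assembled result *)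

Lemma Q_rate_bounds (R : realType) (mu : R) : 0 < mu < 1 ->
  0 < 2 * (1 - Num.sqrt (1 - mu)) / mu - 1 < 1.
Proof.
move=> /andP[mu0 mu1]; set w := Num.sqrt (1 - mu).
have w2 : mu = (1 - w) * (1 + w).
  have h : w ^+ 2 = 1 - mu by apply: sqr_sqrtr; lra.
  by rewrite -[LHS](subKr 1) -h; ring.
have w0 : 0 < w by rewrite sqrtr_gt0 subr_gt0.
have w1 : w < 1.
  by rewrite ltNge; apply/negP => w1; have := mu0; rewrite w2; nra.
(* In terms of [w] the factor [1 - w] cancels, and both bounds become evident. *)
have -> : 2 * (1 - w) / mu - 1 = (1 - w) / (1 + w).
  rewrite w2; field; rewrite !lt0r_neq0//; lra.
by rewrite divr_gt0 ?ltr_pdivrMr; lra.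
Qed.

(** The radicand is [(s + rt) ^+ 2 * (1 - mu)] for [mu = rt / (s + rt)]. *)
Lemma cut_map_slopeE (R : realType) (s rt : R) : 0 < s -> 0 < rt ->
  1 - 2 * (Num.sqrt (s * (s + rt)) - s) / rt =
  2 * (1 - Num.sqrt (1 - rt / (s + rt))) / (rt / (s + rt)) - 1.
Proof.
move=> s0 rt0; have r0 : 0 < s + rt by rewrite addr_gt0.
have -> : s * (s + rt) = (s + rt) ^+ 2 * (1 - rt / (s + rt)).
  by field; exact: lt0r_neq0.
rewrite sqrtrM ?sqr_ge0// sqrtr_sqr ger0_norm ?(ltW r0)//.
by field; rewrite !lt0r_neq0.
Qed.

Theorem theorem5p4 (R : realType) (n : nat) (hn : (2 <= n)%N)
  (s rt r mu : R) (hs : 0 <= s) (hrt : 0 < rt)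
  (hr : r = s + rt) (hmu : mu = rt / r)
  (K M : 'M[R[i]]_n)
  (hK : field_of_values K = [set z : R[i] | `|z| <= 1])
  (hM : M = (s%:C)%:M + rt%:C *: K)
  (j : nat) (phi t : nat -> R) (b c d : nat -> R[i])
  (hb : b j = s%:C + rt%:C * expi (phi j))
  (hphi : 0 < phi j < pi / 2%:R)
  (hbr : `|b j| < r%:C) (hrtr : rt < r)
  (hcuts : forall k : nat, (j <= k)%N ->
     optimal_cut M s r (phi k) (t k) (b k) (c k) (d k) (b k.+1)) :
  0 < mu < 1 /\
  (forall k : nat, (j <= k)%N ->
     t k = - s * sin (phi k)
           + Num.sqrt (s ^+ 2 * sin (phi k) ^+ 2
                       + 2%:R * s * rt * (1 - cos (phi k))) /\
     phi k.+1 = - phi k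
       + 2%:R * atan ((rt * sin (phi k) - t k * cos (phi k))
                      / (rt * cos (phi k) + t k * sin (phi k)))) /\
  Q_linear_cvg (fun k : nat => phi (j + k)%N) 0
    (2%:R * (1 - Num.sqrt (1 - mu)) / mu - 1).
Proof.
subst r.
have s_gt0 : 0 < s by lra.
have mu01 : 0 < mu < 1.
  by rewrite hmu divr_gt0 ?addr_gt0//= ltr_pdivrMr ?addr_gt0// mul1r.
have WM z : field_of_values M z <-> `|z - s%:C| <= rt%:C.
  rewrite hM; have rtC : 0 < rt%:C by rewrite ltcR.
  split=> [/(field_of_values_affine _ _ _ _ _ _ (lt0r_neq0 hrt))|zW].
    by rewrite hK /= normrM normfV (gtr0_norm rtC) ler_pdivrMr// mul1r.
  apply/(field_of_values_affine _ _ _ _ _ _ (lt0r_neq0 hrt)); rewrite hK /=.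
  by rewrite normrM normfV (gtr0_norm rtC) ler_pdivrMr// mul1r.
have cut k : (j <= k)%N -> 0 < phi k < pi / 2 ->
    b k = s%:C + rt%:C * expi (phi k) ->
    [/\ t k = cut_offset R s rt (phi k), phi k.+1 = cut_map R s rt (phi k) &
        b k.+1 = s%:C + rt%:C * expi (phi k.+1)].
  move=> jk phik bk.
  apply: (optimal_cut_map R n M s rt hrt WM _ _ _ _ _ _ _ _ s_gt0 erefl phik bk
    (hcuts k jk)).
  (* The argument of the new point is read off the next cut. *)
  exact: cut_angle (hcuts k.+1 (leqW jk)).
(* The angle range and the position on the circle are carried together, since each cut needs
   both. *)
have inv k : (j <= k)%N ->
    0 < phi k < pi / 2 /\ b k = s%:C + rt%:C * expi (phi k).
  elim: k => [|k IHk]; first by rewrite leqn0 => /eqP j0; rewrite j0 in hphi hb.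
  rewrite leq_eqVlt ltnS => /orP[/eqP <- //|jk].
  have [phik bk] := IHk jk; have [_ phiS bS] := cut k jk phik bk.
  split=> //; rewrite phiS.
  have /andP[m0 /lt_trans m1] := cut_map_bounds R s rt s_gt0 hrt _ phik.
  by rewrite m0 m1//; case/andP: phik.
split=> //; split=> [k jk|].
  have [phik bk] := inv k jk; have [tk phiS _] := cut k jk phik bk.
  split.
    rewrite tk; apply: cut_offsetE; apply/ltW/sin_gt0_pihalf.
    exact: half_bounds.
  by rewrite phiS tk; exact: cut_map_tanE.
pose u k := phi (j + k)%N.
have uS k : u k.+1 = cut_map R s rt (u k).
  have [phik bk] := inv _ (leq_addr k j).
  by rewrite /u addnS; have [] := cut _ (leq_addr k j) phik bk.
have u0 : 0 < u 0%N < pi / 2 by rewrite /u addn0.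
have upos k : 0 < u k by have [/andP[]] := inv _ (leq_addr k j).
split.
- exact: Q_rate_bounds.
- by move=> k; exact: lt0r_neq0 (upos k).
- exact: (cut_orbit_cvg0 R s rt s_gt0 hrt u u0 uS).
- have := cut_orbit_ratio_cvg R s rt s_gt0 hrt u u0 uS.
  rewrite cut_map_slopeE// -hmu => h.
  rewrite (_ : (fun k => _) = fun k => u k.+1 / u k)//.
  apply/funext => k; rewrite !subr0.
  by rewrite (gtr0_norm (upos k)) (gtr0_norm (upos k.+1)).
Qed.
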